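(* Every graph $G$ with no $K_4^-$-minor has a drawing such that two vertices are adjacent if and only if they are unit-distance apart. In particular, $G$ is isomorphic to a unit-distance graph and $\mathrm{dn}'(G)=\mathrm{dn}(G)=1$.
   Context: $K_4^-$ is the graph obtained from $K_4$ by deleting one edge. A degenerate drawing of a graph maps vertices to distinct points in the plane and each edge to the open straight-line segment joining its endpoints; a drawing is a degenerate drawing in which no vertex lies in the interior of an edge. The distance-number $\mathrm{dn}(G)$ (resp. degenerate distance-number $\mathrm{dn}'(G)$) is the minimum number of distinct edge-lengths over all drawings (resp. degenerate drawings) of $G$. The unit-distance graph of a point set $S$ in the plane has vertex set $S$, with two points adjacent iff they are at distance $1$.
   Formalization: The equality dn'(G)=dn(G)=1 is stated only for graphs with at least one edge, since an edgeless graph has no edge-lengths and hence dn'(G)=dn(G)=0; the other claims hold for every (finite) graph with no K_4^- minor. *)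

(* Defs.v *)
From HB Require Import structures.
From mathcomp Require Import all_boot all_order all_algebra.
From mathcomp Require Import ring.

Set Implicit Arguments.
Unset Strict Implicit.
Unset Printing Implicit Defensive.

Import Order.TTheory GRing.Theory Num.Theory.

Local Open Scope ring_scope.

Record sgraph := SGraph {
  vertex :> finType;
  adj : rel vertex;
  adj_sym : symmetric adj;
  adj_irr : irreflexive adj }.

Definition graph_iso (T U : Type) (e : rel T) (e' : rel U) : Prop :=
  exists2 f : T -> U, bijective f & {mono f : x y / e x y >-> e' x y}.

Section Complete.
Variable n : nat.

Definition complete_adj : rel 'I_n := fun x y => x != y.

Lemma complete_adj_sym : symmetric complete_adj.
Proof. by move=> x y; rewrite /complete_adj eq_sym. Qed.

Lemma complete_adj_irr : irreflexive complete_adj.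
Proof. by move=> x; rewrite /complete_adj eqxx. Qed.

Definition complete : sgraph := SGraph complete_adj_sym complete_adj_irr.

End Complete.

Section DelEdge.
Variables (G : sgraph) (a b : G).

Definition del_edge_adj : rel G :=
  fun x y => adj x y && ([set x; y] != [set a; b]).

Lemma del_edge_adj_sym : symmetric del_edge_adj.
Proof. by move=> x y; rewrite /del_edge_adj adj_sym setUC. Qed.

Lemma del_edge_adj_irr : irreflexive del_edge_adj.
Proof. by move=> x; rewrite /del_edge_adj adj_irr. Qed.

Definition del_edge : sgraph := SGraph del_edge_adj_sym del_edge_adj_irr.

End DelEdge.

Definition K4minus : sgraph := del_edge (G := complete 4) ord0 ord_max.

Definition connected_set (G : sgraph) (A : {set G}) : Prop :=
  A != set0 /\
  {in A &, forall x y,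
     connect [rel u v : G | [&& u \in A, v \in A & adj u v]] x y}.

(* The vertex h of the minor is obtained by contracting the connected subgraph
   of G induced by B h; vertices in no B h are deleted. *)
Definition minor (H G : sgraph) : Prop :=
  exists B : H -> {set G},
    [/\ forall h, connected_set (B h),
        forall h k, h != k -> [disjoint B h & B k]
      & forall h k, adj h k ->
          exists x y, [/\ x \in B h, y \in B k & adj x y]].

From mathcomp Require Import boolp classical_sets reals.

Local Open Scope classical_set_scope.

Section Plane.
Variable R : realType.

Definition plane : Type := (R * R)%type.

(* The library's norm on R * R is the sup norm, so the Euclidean distance
   is written out. *)
Definition dist (a b : plane) : R :=
  Num.sqrt ((a.1 - b.1) ^+ 2 + (a.2 - b.2) ^+ 2).

Definition open_segment (a b : plane) : set plane :=
  [set c | exists2 t : R, 0 < t < 1 &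
     c = ((1 - t) * a.1 + t * b.1, (1 - t) * a.2 + t * b.2)].

Definition unit_distance (S : set plane) : rel S :=
  fun a b => dist (val a) (val b) == 1.

Variable G : sgraph.

(* A drawing is given by the positions of the vertices: the edge xy is then
   drawn as open_segment (p x) (p y). *)
Definition degenerate_drawing (p : G -> plane) : Prop := injective p.

Definition drawing (p : G -> plane) : Prop :=
  degenerate_drawing p /\
  forall x y z : G, adj x y -> ~ open_segment (p x) (p y) (p z).

Definition edge_lengths (p : G -> plane) : seq R :=
  undup [seq dist (p u.1) (p u.2) | u : G * G in [pred u | adj u.1 u.2]].

Definition num_lengths (p : G -> plane) : nat := size (edge_lengths p).

Lemma drawing_exists : exists p : G -> plane, drawing p.
Proof.
pose q (x : G) : R := (enum_rank x)%:R.
have qI : injective q.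
  by move=> x y /eqP; rewrite eqr_nat => /eqP/val_inj/enum_rank_inj.
exists (fun x => (q x, q x ^+ 2)); split=> [x y [/qI]//|x y z xy].
move=> [t /andP[t0 t1]] /= [e1 e2].
have xDy : q x - q y != 0.
  by rewrite subr_eq0; apply: contraTneq xy => /qI ->; rewrite adj_irr.
have : 0 < t * (1 - t) * (q x - q y) ^+ 2.
  by rewrite pmulr_rgt0 ?exprn_even_gt0 // mulr_gt0 ?subr_gt0.
suff -> : t * (1 - t) * (q x - q y) ^+ 2 = 0 by rewrite ltxx.
move: e2; rewrite e1 => /eqP; rewrite -subr_eq0 => /eqP e2.
by rewrite -[RHS]oppr0 -e2; ring.
Qed.

Lemma dn_exists :
  exists k, `[< exists2 p : G -> plane, drawing p & num_lengths p = k >].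
Proof.
by have [p Dp] := drawing_exists; exists (num_lengths p); apply/asboolP; exists p.
Qed.

Lemma dn'_exists :
  exists k,
    `[< exists2 p : G -> plane, degenerate_drawing p & num_lengths p = k >].
Proof.
have [p [Dp _]] := drawing_exists.
by exists (num_lengths p); apply/asboolP; exists p.
Qed.

Definition dn : nat := ex_minn dn_exists.

Definition dn' : nat := ex_minn dn'_exists.

End Plane.

(* Main.v *)
(* A graph without K4minus minor is a cactus: if c is a cycle of G and G - E(c)
   connected two vertices of c, then c and a connecting path would form a theta
   graph, whose contraction contains K4minus.  A bridge has the same separation
   property when regarded as a cycle of length 2.  So an induced subgraph either has a
   proper cover by two parts without cross edges that share at most one vertex,
   or it is exactly such a cycle.  A cycle is drawn as a regular polygon with unit
   side.  Two drawings sharing at most one point are glued at the origin after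
   rotating one of them: each unwanted coincidence puts the direction of the
   rotation on a line, so that all but finitely many rotations avoid them all. *)
Require Import Defs.
From mathcomp Require Import all_boot all_order all_algebra.
From mathcomp Require Import boolp classical_sets reals.
From mathcomp Require Import trigo.
From mathcomp Require Import ring lra zify.

Set Implicit Arguments.
Unset Strict Implicit.
Unset Printing Implicit Defensive.

Import Order.TTheory GRing.Theory Num.Theory.

Local Open Scope ring_scope.

(** * Properties that fail for finitely many parameters *)

Section Generic.
Variable R : realType.

(* [P] holds for all but finitely many [t]. *)
Definition generic (P : R -> Prop) : Prop :=
  exists2 q : {poly R}, q != 0 & forall t, ~~ root q t -> P t.

Lemma generic_exists P : generic P -> exists t, P t.
Proof.
(* A nonzero polynomial has fewer roots than its size, so one of these [size q] distinct points is
   not a root. *)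
case=> q q0 Pq; pose s : seq R := [seq i%:R | i <- iota 0 (size q)].
have us : uniq s.
  by rewrite map_inj_uniq ?iota_uniq //; exact: (mulrIn (oner_neq0 R)).
suff /allPn[t _ /Pq Pt] : ~~ all (root q) s by exists t.
apply/negP => qs; have := max_poly_roots q0 qs us.
by rewrite size_map size_iota ltnn.
Qed.

Lemma generic_sub (P Q : R -> Prop) :
  (forall t, P t -> Q t) -> generic P -> generic Q.
Proof. by move=> PQ [q q0 Pq]; exists q => // t /Pq /PQ. Qed.

Lemma generic_and P Q : generic P -> generic Q -> generic (fun t => P t /\ Q t).
Proof.
case=> p p0 Pp [q q0 Qq]; exists (p * q); first by rewrite mulf_neq0.
by move=> t; rewrite rootM negb_or => /andP[/Pp ? /Qq].
Qed.

(** Lets the polynomial be built under [H]; if [H] fails, the constant 1 serves. *)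
Lemma generic_imply (H : Prop) P :
  (H -> generic P) -> generic (fun t => H -> P t).
Proof.
move=> HP; have [/HP|nH] := pselect H; first exact: generic_sub.
by exists 1; rewrite ?oner_neq0.
Qed.

Lemma generic_forall (I : finType) (P : I -> R -> Prop) :
  (forall i, generic (P i)) -> generic (fun t => forall i, P i t).
Proof.
move=> gP.
suff [q q0 Pq] : generic (fun t => forall i, i \in enum I -> P i t).
  by exists q => // t /Pq Pt i; apply: Pt; rewrite mem_enum.
elim: (enum I) => [|i s IH]; first by exists 1; rewrite ?oner_neq0.
apply: generic_sub (generic_and (gP i) IH) => t [Pi Ps] j.
by rewrite in_cons => /predU1P[->|/Ps].
Qed.

Lemma generic_neq (a : R) : generic (fun t => t != a).
Proof.
by exists ('X - a%:P); rewrite ?polyXsubC_eq0 // => t; rewrite root_XsubC.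
Qed.

(* Rational parametrization of the unit circle, which turns lines into
   polynomial conditions on [t]. *)
Definition ucos (t : R) := (1 - t ^+ 2) / (1 + t ^+ 2).
Definition usin (t : R) := (2 * t) / (1 + t ^+ 2).

Lemma onePsqr_neq0 (t : R) : 1 + t ^+ 2 != 0.
Proof. by rewrite gt_eqF // ltr_pwDl ?ltr01 ?sqr_ge0. Qed.

Lemma ucos2Dusin2 t : ucos t ^+ 2 + usin t ^+ 2 = 1.
Proof. by rewrite /ucos /usin; field; exact: onePsqr_neq0. Qed.

(** Clearing the denominator [1 + t ^+ 2] turns equality into the vanishing of a quadratic in [t],
    whose coefficients are all zero only if [a = b = 0]. *)
Lemma generic_off_line (a b d : R) : a != 0 \/ b != 0 ->
  generic (fun t => a * ucos t + b * usin t != d).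
Proof.
move=> ab0.
exists ((- a - d) *: 'X^2 + (2 * b) *: 'X + (a - d)%:P).
  apply/eqP => /polyP q0; have := (q0 0%N, q0 1%N, q0 2%N).
  rewrite !coefE /= => -[[]].
  rewrite !(mulr0, mulr1, addr0, add0r) => e0 e1 e2.
  by case: ab0 => /eqP; apply; lra.
move=> t; apply: contraNneq => e.
rewrite rootE !(hornerD, hornerZ, hornerXn, hornerX, hornerC); apply/eqP.
have h := onePsqr_neq0 t.
have -> : d = (a * (1 - t ^+ 2) + b * (2 * t)) / (1 + t ^+ 2).
  by rewrite -e /ucos /usin; field.
by field.
Qed.

End Generic.

(** * Rotations and the coincidences that they avoid *)

Section Euclid.
Variable R : realType.
Implicit Types a b c z : plane R.

Definition sqdist a b : R := (a.1 - b.1) ^+ 2 + (a.2 - b.2) ^+ 2.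

Lemma dist_eq1 a b : dist a b = 1 <-> sqdist a b = 1.
Proof.
have d0 : 0 <= sqdist a b by rewrite addr_ge0 ?sqr_ge0.
rewrite /dist -/(sqdist a b); split=> [e|->]; last by rewrite sqrtr1.
by rewrite -(sqr_sqrtr d0) e expr1n.
Qed.

Definition rotate t z : plane R :=
  (ucos t * z.1 - usin t * z.2, usin t * z.1 + ucos t * z.2).

Lemma rotate0 t z : z.1 = 0 -> z.2 = 0 -> rotate t z = z.
Proof. by case: z => x y /= -> ->; rewrite /rotate /= !mulr0 subr0 addr0. Qed.

Lemma sqdist_rotate t a b : sqdist (rotate t a) (rotate t b) = sqdist a b.
Proof.
rewrite /sqdist /rotate /=; set c := ucos t; set s := usin t.
transitivity ((c ^+ 2 + s ^+ 2) * ((a.1 - b.1) ^+ 2 + (a.2 - b.2) ^+ 2)).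
  by ring.
by rewrite ucos2Dusin2 mul1r.
Qed.

Lemma rotate_inj t : injective (rotate t).
Proof.
move=> a b e; have : sqdist a b = 0.
  by rewrite -(sqdist_rotate t) e /sqdist !subrr expr0n addr0.
move/eqP; rewrite paddr_eq0 ?sqr_ge0 // !sqrf_eq0 !subr_eq0.
by case: a b {e} => [a1 a2] [b1 b2] /= /andP[/eqP-> /eqP->].
Qed.

Lemma open_segment_rotate t a b c :
  open_segment (rotate t a) (rotate t b) (rotate t c) -> open_segment a b c.
Proof.
case=> u u01 e; exists u => //; apply: (@rotate_inj t); rewrite e /rotate /=.
by congr pair; ring.
Qed.

Lemma open_segment_translate v a b c :
  open_segment (a.1 + v.1, a.2 + v.2) (b.1 + v.1, b.2 + v.2)
    (c.1 + v.1, c.2 + v.2) -> open_segment a b c.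
Proof.
case=> u u01 [/= e1 e2]; exists u => //; rewrite [LHS]surjective_pairing.
by congr pair; [apply: (addIr v.1); rewrite e1 | apply: (addIr v.2); rewrite e2];
  ring.
Qed.

(** Twice the signed area of the triangle. Its vanishing replaces membership in a segment by the
    weaker condition of collinearity. *)
Definition cross a b c : R :=
  (b.1 - a.1) * (c.2 - a.2) - (b.2 - a.2) * (c.1 - a.1).

Lemma open_segment_cross a b c : open_segment a b c -> cross a b c = 0.
Proof. by case=> u _ ->; rewrite /cross /=; ring. Qed.

Definition nonzero a := a.1 != 0 \/ a.2 != 0.

(** The squares of the two expressions add up to the product of the squared norms of [a] and [z].
    They are the coefficients of [ucos t] and [usin t] in the dot product of [rotate t z] with
    [a]. *)
Lemma dot_cross_neq0 a z : nonzero a -> nonzero z ->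
  z.1 * a.1 + z.2 * a.2 != 0 \/ z.1 * a.2 - z.2 * a.1 != 0.
Proof.
move=> a0 z0; apply/orP; rewrite -negb_and; apply/negP => /andP[/eqP h1 /eqP h2].
have : (z.1 ^+ 2 + z.2 ^+ 2) * (a.1 ^+ 2 + a.2 ^+ 2) = 0.
  transitivity ((z.1 * a.1 + z.2 * a.2) ^+ 2
    + (z.1 * a.2 - z.2 * a.1) ^+ 2); first by ring.
  by rewrite h1 h2 expr0n addr0.
move/eqP; rewrite mulf_eq0 !paddr_eq0 ?sqr_ge0 // !sqrf_eq0.
case/orP => /andP[/eqP e1 /eqP e2].
  by case: z0; rewrite ?e1 ?e2 eqxx.
by case: a0; rewrite ?e1 ?e2 eqxx.
Qed.

Lemma generic_rotate_dot a z d : nonzero a -> nonzero z ->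
  generic (fun t => (rotate t z).1 * a.1 + (rotate t z).2 * a.2 != d).
Proof.
move=> a0 z0; apply: generic_sub (generic_off_line d (dot_cross_neq0 a0 z0)).
by move=> t; apply: contraNN => /eqP <-; rewrite /rotate /=; apply/eqP; ring.
Qed.

Lemma generic_rotate_neq a z : nonzero a -> nonzero z ->
  generic (fun t => rotate t z <> a).
Proof.
move=> a0 z0.
(* This quarter turn of [a] is orthogonal to [a], so a coincidence makes the dot product 0. *)
have b0 : nonzero (a.2, - a.1) by case: a0; [right|left]; rewrite //= oppr_eq0.
apply: generic_sub (generic_rotate_dot 0 b0 z0) => t /eqP h e; apply: h.
by rewrite e /=; ring.
Qed.

(** Since [rotate t z] has the norm of [z], unit distance from [a] prescribes its dot product with
    [a], namely [d]. *)
Lemma generic_rotate_sqdist a z : nonzero a -> nonzero z ->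
  generic (fun t => sqdist a (rotate t z) <> 1).
Proof.
move=> a0 z0.
pose d := (a.1 ^+ 2 + a.2 ^+ 2 + (z.1 ^+ 2 + z.2 ^+ 2) - 1) / 2.
apply: generic_sub (generic_rotate_dot d a0 z0) => t /eqP h e; apply: h.
rewrite /d; have -> : z.1 ^+ 2 + z.2 ^+ 2 = (rotate t z).1 ^+ 2 + (rotate t z).2 ^+ 2.
  transitivity ((ucos t ^+ 2 + usin t ^+ 2) * (z.1 ^+ 2 + z.2 ^+ 2)).
    by rewrite ucos2Dusin2 mul1r.
  by rewrite /rotate /=; ring.
by move: e; rewrite /sqdist; lra.
Qed.

Lemma neq_nonzero a b : a <> b -> nonzero (b.1 - a.1, b.2 - a.2).
Proof.
move=> ab; apply/orP; rewrite /= -negb_and !subr_eq0; apply/negP.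
by case: a b ab => [a1 a2] [b1 b2] /= ab /andP[/eqP e1 /eqP e2]; rewrite e1 e2 in ab.
Qed.

Lemma generic_rotate_segment a z z' : nonzero a -> z <> z' ->
  generic (fun t => ~ open_segment (rotate t z) (rotate t z') a).
Proof.
move=> a0 /neq_nonzero w0; set w := (_, _) in w0.
have b0 : nonzero (a.2, - a.1) by case: a0; [right|left]; rewrite //= oppr_eq0.
(* Rotation preserves cross products, so collinearity says that the rotated [w] has cross product
   [d] with [a], that is, dot product [d] with [(a.2, - a.1)]. *)
pose d := w.1 * z.2 - w.2 * z.1.
apply: generic_sub (generic_rotate_dot d b0 w0) => t /eqP h.
move/open_segment_cross; rewrite /cross => e; apply: h.
transitivity ((ucos t ^+ 2 + usin t ^+ 2) * d); last by rewrite ucos2Dusin2 mul1r.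
by apply/eqP; rewrite -subr_eq0 -e /d /w /rotate /=; apply/eqP; ring.
Qed.

Lemma generic_segment_rotate a a' z : a <> a' -> nonzero z ->
  generic (fun t => ~ open_segment a a' (rotate t z)).
Proof.
move=> /neq_nonzero; set w := (_, _) => w0 z0.
(* Here the line is fixed and this is its normal; collinearity prescribes the dot product of the
   moving point with it. *)
have b0 : nonzero (- w.2, w.1) by case: w0; [right|left]; rewrite //= oppr_eq0.
apply: generic_sub (generic_rotate_dot (w.1 * a.2 - w.2 * a.1) b0 z0) => t /eqP h.
move/open_segment_cross; rewrite /cross => e; apply: h.
by apply/eqP; rewrite -subr_eq0 -e /=; apply/eqP; ring.
Qed.

End Euclid.

(** * Drawings of induced subgraphs *)

Section Realization.
Variables (R : realType) (G : sgraph).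
Implicit Types (A B : {set G}) (p q r : G -> plane R).

(** [p] is total, so that induced subgraphs need no type of their own; its values outside [A] are
    arbitrary. *)
Definition realizes A p : Prop :=
  [/\ forall x y, x \in A -> y \in A -> p x = p y -> x = y,
      forall x y, x \in A -> y \in A -> adj x y <-> sqdist (p x) (p y) = 1
    & forall x y z, x \in A -> y \in A -> z \in A -> adj x y ->
        ~ open_segment (p x) (p y) (p z)].

Definition realizable A : Prop := exists p, realizes A p.

Lemma realizes_translate (v : plane R) A p :
  realizes A p -> realizes A (fun x => ((p x).1 + v.1, (p x).2 + v.2)).
Proof.
case=> pI pd ps; split.
- move=> x y xA yA [/addIr e1 /addIr e2]; apply: pI => //.
  by rewrite [LHS]surjective_pairing e1 e2 -surjective_pairing.
- move=> x y xA yA; rewrite pd // /sqdist /=.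
  by rewrite !opprD !addrA [_ + v.1 - _]addrAC addrK
    [_ + v.2 - _]addrAC addrK.
- by move=> x y z xA yA zA xy /open_segment_translate; exact: ps.
Qed.

(** Moves a drawing off the origin, the centre of rotation, when no common vertex has to be placed
    there. *)
Lemma generic_translate p :
  generic (fun t : R => forall x, nonzero ((p x).1 + t, (p x).2 + 0)).
Proof.
apply: generic_forall => x; apply: generic_sub (generic_neq (- (p x).1)) => t h.
by left; rewrite /= addrC addr_eq0.
Qed.

Lemma realizable_glue_at0 A B p q :
    realizes A p -> realizes B q ->
    {in A :\: B & B :\: A, forall x y, ~~ adj x y} ->
    {in A :&: B, forall v, p v = (0, 0) /\ q v = (0, 0)} ->
    {in A :\: B, forall x, nonzero (p x)} ->
    {in B :\: A, forall x, nonzero (q x)} ->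
  realizable (A :|: B).
Proof.
move=> [pI pd ps] [qI qd qs] AB pq0 p0 q0.
(* The conditions on the rotation: no coinciding vertices, no unit distance across the parts, and no
   vertex of one part inside a segment spanned by the other. *)
have : generic (fun t => forall x y z,
    (x \in A :\: B -> y \in B :\: A -> rotate t (q y) <> p x /\
       sqdist (p x) (rotate t (q y)) <> 1) /\
    ((x \in A :\: B /\ y \in B /\ z \in B /\ y != z ->
       ~ open_segment (rotate t (q y)) (rotate t (q z)) (p x)) /\
     (x \in A /\ z \in A /\ y \in B :\: A /\ x != z ->
       ~ open_segment (p x) (p z) (rotate t (q y))))).
  do 3![apply: generic_forall => ?]; apply: generic_and; last apply: generic_and.
  - apply: generic_imply => /p0 ?; apply: generic_imply => /q0 ?.
    by apply: generic_and; [apply: generic_rotate_neq|apply: generic_rotate_sqdist].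
  - apply: generic_imply => -[/p0 ? [yB [zB yz]]].
    by apply: generic_rotate_segment => // /qI e; move: yz; rewrite e ?eqxx.
  - apply: generic_imply => -[xA [zA [/q0 ? xz]]].
    by apply: generic_segment_rotate => // /pI e; move: xz; rewrite e ?eqxx.
case/generic_exists => t tP.
(* The rotation fixes the origin, so both branches agree on [A :&: B]. *)
pose r x := if x \in A then p x else rotate t (q x).
have rA x : x \in A -> r x = p x by rewrite /r => ->.
have rB x : x \in B -> r x = rotate t (q x).
  rewrite /r => xB; case: ifP => // xA.
  by have [|-> ->] := pq0 x; rewrite ?inE ?xA // rotate0.
(* A symmetric relation has to be checked only inside [A], inside [B] and across. *)
have same P : (forall x y, P x y -> P y x) ->
    (forall x y, x \in A -> y \in A -> P x y) ->
    (forall x y, x \in B -> y \in B -> P x y) ->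
    (forall x y, x \in A :\: B -> y \in B :\: A -> P x y) ->
    forall x y, x \in A :|: B -> y \in A :|: B -> P x y.
  move=> Ps PA PB PAB x y; rewrite !inE.
  have {}PAB x' y' : x' \in A -> x' \notin B -> y' \in B -> y' \notin A -> P x' y'.
    by move=> *; apply: PAB; rewrite inE; apply/andP.
  case: (boolP (x \in A)) (boolP (x \in B)) => [xA|xA] [xB|xB] //= _;
  case: (boolP (y \in A)) (boolP (y \in B)) => [yA|yA] [yB|yB] //= _; by auto.
have sqdistC a b : sqdist a b = sqdist b a :> R.
  by rewrite /sqdist; ring.
exists r; split.
- apply: same => [x y h /esym/h //|x y xA yA|x y xB yB|x y xA yB].
  + by rewrite !rA //; exact: pI.
  + by rewrite !rB // => /rotate_inj; exact: qI.
  + have [/(_ xA yB)[h _] _] := tP x y x.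
    by rewrite rA ?rB => [/esym//||]; move: xA yB; rewrite !inE => /andP[_ ?] /andP[_ ?].
- apply: same => [x y|x y xA yA|x y xB yB|x y xA yB].
  + by rewrite adj_sym sqdistC.
  + by rewrite !rA //; exact: pd.
  + by rewrite !rB // sqdist_rotate; exact: qd.
  + have [/(_ xA yB)[_ h] _] := tP x y x.
    rewrite rA ?rB ?(negbTE (AB _ _ xA yB)) //;
    by move: xA yB; rewrite !inE => /andP[_ ?] /andP[_ ?].
move=> x y z xAB yAB zAB xy.
have xNy : x != y by apply: contraTneq xy => ->; rewrite adj_irr.
(* No edge crosses, so both ends of an edge lie in a common part; only the third vertex may be
   elsewhere. *)
have [[xA yA]|[xB yB]] : (x \in A /\ y \in A) \/ (x \in B /\ y \in B).
  apply: (@same (fun x y => adj x y -> (x \in A /\ y \in A) \/ (x \in B /\ y \in B)))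
    xAB yAB xy => {x y xNy} [x y|x y|x y|x y xA yB]; [|by auto|by auto|].
  + by rewrite adj_sym => h /h; tauto.
  + by rewrite (negbTE (AB _ _ xA yB)).
- rewrite !(rA x, rA y) //; case: (boolP (z \in A)) => [zA|zA].
    by rewrite rA //; exact: ps.
  have zB : z \in B by move: zAB; rewrite inE (negbTE zA).
  by rewrite rB //; have [_ [_]] := tP x z y; apply; rewrite !inE zA zB.
- rewrite !(rB x, rB y) //; case: (boolP (z \in B)) => [zB|zB].
    by rewrite rB // => /open_segment_rotate; exact: qs.
  have zA : z \in A by move: zAB; rewrite inE (negbTE zB) orbF.
  by rewrite rA //; have [_ [+ _]] := tP z x y; apply; rewrite !inE zA zB.
Qed.

(** A common vertex is moved to the origin in both drawings; disjoint parts are instead moved so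
    that no vertex is at the origin. *)
Lemma realizable_glue A B :
    realizable A -> realizable B ->
    {in A :\: B & B :\: A, forall x y, ~~ adj x y} ->
    (#|A :&: B| <= 1)%N ->
  realizable (A :|: B).
Proof.
move=> [p pA] [q qB] AB; rewrite leq_eqVlt ltnS leqn0 cards_eq0.
case/orP => [/cards1P[v ABv]|/eqP AB0].
- have [vA vB] : v \in A /\ v \in B.
    by apply/setIP; rewrite ABv set11.
  apply: (realizable_glue_at0
    (realizes_translate (- (p v).1, - (p v).2) pA)
    (realizes_translate (- (q v).1, - (q v).2) qB)) => //.
  + by move=> x; rewrite ABv => /set1P ->; rewrite !subrr.
  + move=> x /setDP[xA xB]; apply: (@neq_nonzero _ (p v) (p x)).
    by case: pA => pI _ _ /pI e; move: xB; rewrite -e ?vB.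
  + move=> x /setDP[xB xA]; apply: (@neq_nonzero _ (q v) (q x)).
    by case: qB => qI _ _ /qI e; move: xA; rewrite -e ?vA.
- have [t pt] := generic_exists (generic_translate p).
  have [u qu] := generic_exists (generic_translate q).
  apply: (realizable_glue_at0 (realizes_translate (t, 0) pA)
    (realizes_translate (u, 0) qB)) => // x.
  by rewrite AB0 inE.
Qed.

Lemma realizable_le1 A : (#|A| <= 1)%N -> realizable A.
Proof.
move/card_le1_eqP => A1; exists (fun _ => (0, 0)).
split=> x y; first by move=> xA yA _; apply: A1.
  move=> xA yA; rewrite (A1 _ _ xA yA) adj_irr /sqdist subrr expr0n addr0.
  by split=> // /eqP; rewrite eq_sym oner_eq0.
by move=> z xA yA; rewrite (A1 _ _ xA yA) adj_irr.
Qed.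

End Realization.

(** * Cycles and regular polygons *)

Lemma index_next (T : eqType) (c : seq T) x : uniq c -> x \in c ->
  index (next c x) c = ((index x c).+1 %% size c)%N.
Proof.
move=> uc xc; rewrite next_nth xc; case: c uc xc => // y c uc xc.
have := xc; rewrite -index_mem leq_eqVlt => /predU1P[e|lt]; last first.
  by rewrite modn_small //; apply: (@index_uniq _ y _.+1 (y :: c)).
(* For the last element the lookup overshoots the tail [c] and returns its default, the head [y], of
   index 0. *)
have ec : index x (y :: c) = size c by case: e.
by rewrite e modnn ec nth_default //= eqxx.
Qed.

Lemma next_eq_index (T : eqType) (c : seq T) x y : uniq c -> x \in c -> y \in c ->
  (next c x == y) = (index y c == (index x c).+1 %% size c)%N.
Proof.
move=> uc xc yc; rewrite -index_next //; apply/eqP/eqP => [->//|e].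
by rewrite -(nth_index x yc) e nth_index // mem_next.
Qed.

(** Strict convexity of the disc: at parameter [t] the squared norm falls short of
    [(1 - t) |a|^2 + t |b|^2] by [t (1 - t) |b - a|^2]. *)
Lemma circle_segment (R : realType) (d : R) (a b c : plane R) :
    a.1 ^+ 2 + a.2 ^+ 2 = d -> b.1 ^+ 2 + b.2 ^+ 2 = d ->
    c.1 ^+ 2 + c.2 ^+ 2 = d -> a <> b ->
  ~ open_segment a b c.
Proof.
move=> ad bd cd /neq_nonzero ab [t /andP[t0 t1] cE]; rewrite {}cE /= in cd.
have : t * (1 - t) * sqdist b a = 0.
  transitivity ((1 - t) * (a.1 ^+ 2 + a.2 ^+ 2) +
     t * (b.1 ^+ 2 + b.2 ^+ 2) - d); first by rewrite -cd /sqdist; ring.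
  by rewrite ad bd; ring.
move/eqP; rewrite !mulf_eq0 gt_eqF //= subr_eq0 gt_eqF //= paddr_eq0 ?sqr_ge0 //.
by rewrite !sqrf_eq0; case: ab => /= /negbTE ->; rewrite ?andbF.
Qed.

Section Polygon.
Variables (R : realType) (n : nat).
Hypothesis n_gt1 : (1 < n)%N.

Definition angle : R := pi *+ 2 / n%:R.

Let n_gt0 : (0 : R) < n%:R.
Proof. by rewrite ltr0n ltnW. Qed.

Lemma angle_gt0 : 0 < angle.
Proof. by rewrite divr_gt0 // mulr2n addr_gt0 ?pi_gt0. Qed.

Lemma cos_angle_compl k : (k <= n)%N ->
  cos (k%:R * angle) = cos ((n - k)%:R * angle).
Proof.
move=> kn; rewrite natrB // mulrBl -[RHS]cosN opprB -[RHS]cosD2pi; congr cos.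
by rewrite /angle; field; rewrite gt_eqF.
Qed.

Lemma cos_angle_inj k m : (k.*2 <= n)%N -> (m.*2 <= n)%N ->
  cos (k%:R * angle) = cos (m%:R * angle) -> k = m.
Proof.
have half j : (j.*2 <= n)%N -> j%:R * angle \in `[0 : R, pi].
  move=> jn; rewrite in_itv /= mulr_ge0 ?(ltW angle_gt0) //= /angle mulrA ler_pdivrMr //.
  have -> : j%:R * (pi *+ 2) = pi * (j.*2)%:R :> R by rewrite -muln2 natrM; ring.
  by rewrite ler_wpM2l ?pi_ge0 // ler_nat.
move=> hk hm e; have := cos_inj (half k hk) (half m hm) e.
move/(mulIf (lt0r_neq0 angle_gt0))/eqP.
by rewrite eqr_nat => /eqP.
Qed.

(** Multiples beyond [pi] are reflected into [[0, pi]] by [cos_angle_compl]; there cosine is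
    injective. *)
Lemma cos_angle_eq k m : (k <= n)%N -> (m <= n)%N ->
  cos (k%:R * angle) = cos (m%:R * angle) -> k = m \/ (k + m)%N = n.
Proof.
move=> kn mn; case: (leqP k.*2 n) (leqP m.*2 n) => hk [] hm.
- by move/(cos_angle_inj hk hm); left.
- by rewrite [RHS]cos_angle_compl // => /cos_angle_inj h; right; rewrite h //; lia.
- by rewrite [LHS]cos_angle_compl // => /cos_angle_inj h; right; rewrite -h //; lia.
- rewrite [LHS]cos_angle_compl // [RHS]cos_angle_compl // => /cos_angle_inj h.
  by left; have : (n - k = n - m)%N by [apply: h; lia]; lia.
Qed.

Lemma cos_angle_lt1 : cos angle < 1.
Proof.
rewrite lt_neqAle cos_le1 andbT; apply/eqP => e.
have : cos (1%:R * angle) = cos (0%:R * angle) by rewrite mul1r mul0r cos0.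
by move/cos_angle_eq; case=> //; lia.
Qed.

(** The squared circumradius for unit side: a chord at central angle [angle] has squared length
    [2 r^2 (1 - cos angle)]. *)
Definition radius2 : R := (2 * (1 - cos angle))^-1.

Definition polygon (k : nat) : plane R :=
  (Num.sqrt radius2 * cos (k%:R * angle), Num.sqrt radius2 * sin (k%:R * angle)).

Lemma radius2_gt0 : 0 < radius2.
Proof. by rewrite invr_gt0 mulr_gt0 // subr_gt0 cos_angle_lt1. Qed.

Lemma polygon_norm k : (polygon k).1 ^+ 2 + (polygon k).2 ^+ 2 = radius2.
Proof.
by rewrite !exprMn -mulrDr cos2Dsin2 mulr1 sqr_sqrtr // ltW // radius2_gt0.
Qed.

Lemma sqdist_polygon i j : (i <= j)%N ->
  sqdist (polygon i) (polygon j) = 2 * radius2 * (1 - cos ((j - i)%:R * angle)).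
Proof.
move=> ij; rewrite natrB // mulrBl cosB /sqdist.
transitivity ((polygon i).1 ^+ 2 + (polygon i).2 ^+ 2 +
  ((polygon j).1 ^+ 2 + (polygon j).2 ^+ 2) -
  2 * ((polygon j).1 * (polygon i).1 + (polygon j).2 * (polygon i).2)).
  by ring.
rewrite !polygon_norm /polygon /=; have := sqr_sqrtr (ltW radius2_gt0).
by set rho := Num.sqrt _ => <-; ring.
Qed.

Lemma polygon_inj i j : (i < n)%N -> (j < n)%N -> polygon i = polygon j -> i = j.
Proof.
wlog ij : i j / (i <= j)%N.
  move=> h i_n j_n e; case: (leqP i j) => [/h->//|/ltnW/h<-//].
move=> i_n j_n e; have : sqdist (polygon i) (polygon j) = 0.
  by rewrite e /sqdist !subrr expr0n addr0.
rewrite sqdist_polygon // => /eqP; rewrite mulf_eq0 mulf_eq0 pnatr_eq0 /=.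
rewrite gt_eqF ?radius2_gt0 //= subr_eq0 eq_sym => /eqP e1.
have : cos ((j - i)%:R * angle) = cos (0%:R * angle) by rewrite mul0r cos0.
by move/(cos_angle_eq (leq_trans (leq_subr i j) (ltnW j_n)) (leq0n n)); lia.
Qed.

(** By the choice of radius, unit distance means that [j - i] steps and one step have the same
    cosine, so [j - i] is 1 or [n - 1]. For [n = 2] the alternatives coincide. *)
Lemma polygon_unit i j : (i <= j < n)%N ->
  sqdist (polygon i) (polygon j) = 1 <-> (j = i.+1 \/ (i = 0%N /\ j = n.-1)).
Proof.
case/andP=> ij j_n.
have c0 : 1 - cos angle != 0 by rewrite gt_eqF // subr_gt0 cos_angle_lt1.
have -> : sqdist (polygon i) (polygon j) = 1 <->
    cos ((j - i)%:R * angle) = cos (1%:R * angle).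
  rewrite sqdist_polygon // mul1r /radius2; split=> [e|->]; last by field.
  have : 1 - cos ((j - i)%:R * angle) = 1 - cos angle.
    by rewrite -[RHS]mulr1 -[X in _ = _ * X]e; field.
  by lra.
split.
  by move/(cos_angle_eq (leq_trans (leq_subr i j) (ltnW j_n)) (ltnW n_gt1)); lia.
move=> h; have : (j - i = 1 \/ j - i = n - 1)%N by lia.
by case=> -> //; rewrite -cos_angle_compl // ltnW.
Qed.

Lemma polygon_segment i j k : polygon i <> polygon j ->
  ~ open_segment (polygon i) (polygon j) (polygon k).
Proof. exact: (circle_segment (polygon_norm i) (polygon_norm j) (polygon_norm k)). Qed.

End Polygon.

(** Positions in [c] number the corners of the polygon. For size 2 the polygon is a unit segment,
    which draws a bridge. *)
Lemma realizable_cycle (R : realType) (G : sgraph) (c : seq G) :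
    uniq c -> (1 < size c)%N ->
    {in c &, forall x y, adj x y = (next c x == y) || (next c y == x)} ->
  realizable R [set x in c].
Proof.
move=> uc c1 cadj; pose p x : plane R := polygon R (size c) (index x c).
have pI x y : x \in c -> y \in c -> p x = p y -> x = y.
  move=> xc yc /(polygon_inj c1); rewrite !index_mem => /(_ xc yc) e.
  by rewrite -(nth_index x xc) e nth_index.
exists p; split=> [x y|x y|x y z]; rewrite !inE; first exact: pI.
- have sqdistC a b : sqdist a b = sqdist b a :> R by rewrite /sqdist; ring.
  wlog ij : x y / (index x c <= index y c)%N => [h xc yc|xc yc].
    case: (leqP (index x c) (index y c)) => [/h->//|/ltnW/h].
    by rewrite adj_sym sqdistC; apply.
  have ic : (index x c < size c)%N by rewrite index_mem.
  have jc : (index y c < size c)%N by rewrite index_mem.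
  rewrite /p polygon_unit ?ij // cadj // !next_eq_index //.
  move: ic jc ij; move: (index x c) (index y c) => i j ic jc ij.
  have mS k : (k < size c)%N ->
      (k.+1 %% size c = if k.+1 == size c then 0 else k.+1)%N.
    by case: eqP => [->|? ?]; rewrite ?modnn // modn_small //; lia.
  rewrite !mS //; case: (eqVneq i.+1 (size c)) => ?;
  by case: (eqVneq j.+1 (size c)) => ?; split=> h; lia.
- move=> xc yc zc xy; apply: polygon_segment => // /(pI _ _ xc yc) e.
  by move: xy; rewrite e adj_irr.
Qed.

(** * Cycles in graphs without K4minus minor *)

(** Gives disjointness of the branch sets of a minor, listed as blocks of one duplicate-free
    sequence. Out of range the default block is empty. *)
Lemma uniq_flatten_nth_inj (T : eqType) (ss : seq (seq T)) i j z :
  uniq (flatten ss) -> z \in nth [::] ss i -> z \in nth [::] ss j -> i = j.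
Proof.
have sub k (tt : seq (seq T)) : z \in nth [::] tt k -> z \in flatten tt.
  case: (ltnP k (size tt)) => [kt zk|/(nth_default _) ->//].
  by apply/flattenP; exists (nth [::] tt k); rewrite ?mem_nth.
elim: ss i j => [|s ss IH] [|i] [|j] //=; rewrite cat_uniq => /and3P[_ /hasPn ns us].
- by move=> zs /sub /ns; rewrite /= zs.
- by move=> /sub /ns /negbTE /= ->.
- by move=> zi zj; rewrite (IH i j).
Qed.

Section Theta.
Variable G : sgraph.
Implicit Types (x y : G) (p q c : seq G) (A : {set G}).

Lemma connected_path x p : path (@adj G) x p -> connected_set [set z in x :: p].
Proof.
move=> xp; split; first by apply/set0Pn; exists x; rewrite inE mem_head.
set e : rel G := (X in connect X).
have /sym_connect_sym eC : symmetric e.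
  by move=> u v; rewrite /e /= adj_sym; case: (u \in _); rewrite ?andbF.
suff xA : {in x :: p, forall u, connect e x u}.
  by move=> u v; rewrite !inE => uA vA; apply: connect_trans (xA _ vA); rewrite eC xA.
apply: path_connect; rewrite /e.
apply: (@sub_in_path _ [in x :: p] (@adj G)) xp; last exact/allP.
by move=> u v ux vx /=; rewrite !inE in ux vx *; rewrite ux vx.
Qed.

(** The paths [p] and [q] contract to the nonadjacent vertices of [K4minus], [x] together with [r]
    to one vertex of degree three, and [y] alone is the other. Hence [r] may be empty. *)
Lemma theta_minor x y p q r :
    path (@adj G) x (rcons p y) -> path (@adj G) x (rcons q y) -> path (@adj G) x (rcons r y) ->
    p != [::] -> q != [::] -> uniq (x :: y :: p ++ q ++ r) ->
  minor K4minus G.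
Proof.
case: p q => [|a p] // [|b q] // hp hq + _ _ u.
rewrite rcons_path => /andP[xr ry].
move: hp hq; rewrite !rcons_cons /= !rcons_path.
move=> /and3P[xa ap py] /and3P[xb bq qy].
(* In K4minus the vertices 0 and 3 are the nonadjacent ones. *)
pose s := [:: a :: p; x :: r; [:: y]; b :: q].
have us : uniq (flatten s).
  rewrite -(perm_uniq (s1 := x :: y :: (a :: p) ++ (b :: q) ++ r)) //.
  by apply/permP => P; rewrite /s /= !(count_cat, cats0) /= !count_cat /=; ring.
pose B (i : nat) : {set G} := [set z in nth [::] s i].
pose E (i j : nat) := exists u v, [/\ u \in B i, v \in B j & adj u v].
have edge (i j : nat) : (i < j)%N -> (j < 4)%N -> (i, j) != (0, 3)%N -> E i j.
  move: i j => [|[|[|[|i]]]] [|[|[|[|j]]]] //= _ _ _.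
  - by exists a, x; rewrite !inE !eqxx adj_sym.
  - by exists (last a p), y; rewrite !inE -in_cons mem_last.
  - by exists (last x r), y; rewrite !inE -in_cons mem_last.
  - by exists x, b; rewrite !inE !eqxx.
  - by exists y, (last b q); rewrite adj_sym !inE -in_cons mem_last.
exists (fun h : 'I_4 => B h); split=> [h|h k hk|h k].
- case: h => [[|[|[|[|//]]]] ?] /=; exact: connected_path.
- apply/pred0P => z; apply: contraNF hk; rewrite /= !finset.in_set => /andP[zh zk].
  exact/eqP/val_inj/(uniq_flatten_nth_inj us zh zk).
- rewrite /= /del_edge_adj /= => /andP[hk nK].
  have [|] := boolP (h < k)%N => hk'.
    apply: edge => //.
    apply: contraNneq nK => -[h0 k3].
    by rewrite (_ : h = ord0) 1?(_ : k = ord_max) //; apply: val_inj.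
  have kh : (k < h)%N.
    by rewrite ltnNge leq_eqVlt negb_or hk' andbT; apply: contra hk => /eqP/val_inj->.
  have [||v [w [? ? ?]]] := edge k h kh; last by exists w, v; rewrite adj_sym.
    by [].
  apply: contraNneq nK => -[h0 k3].
  by rewrite finset.setUC (_ : k = ord0) 1?(_ : h = ord_max) //; apply: val_inj.
Qed.

(** [next] fixes the points outside [c], so there only pairs [u = v] qualify, and these are never
    adjacent. *)
Definition cycle_edge c : rel G := fun u v => (next c u == v) || (next c v == u).

Definition off_cycle A c : rel G :=
  fun u v => [&& u \in A, v \in A, adj u v & ~~ cycle_edge c u v].

Lemma off_cycle_sym A c : symmetric (off_cycle A c).
Proof.
move=> u v; rewrite /off_cycle /cycle_edge adj_sym orbC.
by case: (u \in A); rewrite ?andbF.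
Qed.

Lemma off_cycle_path_sub A c x p : path (off_cycle A c) x p -> {subset p <= A}.
Proof.
move=> + z; elim: p x => //= y p IH x /andP[/and4P[_ yA _ _] yp].
by rewrite in_cons => /predU1P[->//|]; apply: IH yp.
Qed.

(** The local form of the cactus property: the pieces of [A] hanging at different vertices of [c]
    are linked only through edges of [c]. *)
Definition cycle_separated A c : Prop :=
  {in c &, forall x y, connect (off_cycle A c) x y -> x = y}.

(** A connecting path is cut at its first return [z] to [c]; with the two arcs of [c] between [x]
    and [z] it forms a theta graph. *)
Lemma no_minor_cycle_separated A c : ~ minor K4minus G ->
  uniq c -> cycle (@adj G) c -> (2 < size c)%N -> cycle_separated A c.
Proof.
move=> noK uc cc c2 x y xc yc /connectP[p0 /shortenP[p xp up _] yE].
apply/eqP/negP => /negP xy.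
have cp : has [in c] p.
  apply/hasP; exists y => //; rewrite yE; case: p {xp up} yE => [e|z p _] /=.
    by rewrite e eqxx in xy.
  exact: mem_last.
case/split_find: cp xp up {yE} => z p1 p2 zc p1c.
rewrite cat_path cat_rcons /= => /andP[xp1 _].
rewrite mem_cat in_cons !negb_or cat_uniq /= => up.
have [xp1N xz] : x \notin p1 /\ x != z by case/and3P: up => /and3P[].
have up1 : uniq p1 by case/and3P: up.
case: (rot_to_arc uc xc zc xz) => i q1 q2 _ _ rc.
have : uniq (rot i c) by rewrite rot_uniq.
have : cycle (@adj G) (rot i c) by rewrite rot_cycle.
have p1rot w : w \in p1 -> w \notin rot i c.
  by move=> wp; rewrite mem_rot; move/hasPn: p1c; apply.
have sc : (2 < size (rot i c))%N by rewrite size_rot.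
have nx : next (rot i c) =1 next c by apply: next_rot.
rewrite {}rc in p1rot sc nx *.
rewrite /= rcons_cat /= cat_path /= => /and3P[xq1 q1z zq2] urc.
have {}xq1 : path (@adj G) x (rcons q1 z) by rewrite rcons_path xq1.
have {}zq2 : path (@adj G) x (rcons (rev q2) z).
  have := rev_path (@adj G) z (rcons q2 x); rewrite last_rcons belast_rcons rev_cons => ->.
  by apply: sub_path zq2 => u v; rewrite adj_sym.
have xadj : path (@adj G) x (rcons p1 z).
  by apply: sub_path xp1 => u v /and4P[].
have u3 : uniq (x :: z :: p1 ++ q1 ++ rev q2).
  rewrite (perm_uniq (s2 := p1 ++ x :: q1 ++ z :: q2)); last first.
    by apply/permP => P; rewrite /= !count_cat /= !count_cat /= count_rev; ring.
  rewrite cat_uniq up1 andTb; apply/andP; split; last exact: urc.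
  apply/hasPn => w wr.
  by apply: contraL wr => /p1rot.
(* If the connecting path is the single edge [xz], it is not an edge of [c], so both arcs have inner
   vertices. *)
apply: noK; case: p1 xp1 xadj u3 {p1c p1rot up xp1N up1} => [|a p1] xp1 xadj u3.
  move: xp1; rewrite /= /off_cycle andbT => /and4P[_ _ _].
  rewrite /cycle_edge -!nx => nxt.
  apply: (theta_minor xq1 zq2 xadj).
  - by apply: contraNneq nxt => ->; rewrite /= !eqxx.
  - apply: contraNneq nxt => q20; apply/orP; right.
    have -> : q2 = [::] by rewrite -(revK q2) q20.
    have zq1 : z \notin q1.
      by move: urc; rewrite /= cat_uniq /= negb_or => /and4P[_ _ /andP[]].
    (* With [q2] empty, [z] comes last and its successor is the default of [nth], the head [x]. *)
    rewrite next_nth in_cons mem_cat inE eqxx !orbT /= (negbTE xz) index_cat.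
    by rewrite (negbTE zq1) /= eqxx nth_default ?size_cat ?addn0 ?addn1.
  - by move: u3; rewrite /= cats0.
(* Now the connecting path has inner vertices, and so has at least one arc, since [c] has more than
   two vertices. *)
have [q10|q10] := eqVneq q1 [::]; last first.
  apply: (theta_minor xadj xq1 zq2) => //.
apply: (theta_minor xadj zq2 xq1) => //; last by move: u3; rewrite q10 cats0.
by rewrite -size_eq0 size_rev; move: sc; rewrite q10 /=; case: (q2).
Qed.

(** If [ab] is a bridge of the subgraph induced by [A], it serves as a cycle of length 2; otherwise
    a simple path avoiding this edge closes up to a longer cycle. *)
Lemma exists_separated_cycle A a b : ~ minor K4minus G ->
    a \in A -> b \in A -> adj a b ->
  exists c, [/\ uniq c, {subset c <= A}, (1 < size c)%N, cycle (@adj G) c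
              & cycle_separated A c].
Proof.
move=> noK aA bA ab.
have aNb : a != b by apply: contraTneq ab => ->; rewrite adj_irr.
have [/connectP[p0 /shortenP[p ap up _] bE]|ncab] :=
    boolP (connect (off_cycle A [:: a; b]) a b); last first.
  exists [:: a; b]; split=> //=.
  - by rewrite inE aNb.
  - by move=> z; rewrite !inE => /orP[] /eqP ->.
  - by rewrite ab adj_sym ab.
  - move=> x y; rewrite !inE => /orP[] /eqP -> /orP[] /eqP -> //.
      by rewrite (negbTE ncab).
    by rewrite (sym_connect_sym (@off_cycle_sym A _)) (negbTE ncab).
have p2 : (2 < size (a :: p))%N.
  case: p ap bE {up} => [|z [|w p]] //=.
    by move=> _ e; rewrite e eqxx in aNb.
  by move=> + e; rewrite -e andbT => /and4P[_ _ _]; rewrite /cycle_edge /= !eqxx.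
have cp : cycle (@adj G) (a :: p).
  rewrite /= rcons_path -bE adj_sym ab andbT.
  by apply: sub_path ap => u v /and4P[].
exists (a :: p); split=> //; last by apply: no_minor_cycle_separated.
- by move=> z; rewrite in_cons => /predU1P[->//|]; apply: off_cycle_path_sub ap _.
- exact: ltnW.
Qed.

End Theta.

(** * Induction over induced subgraphs *)

Lemma realizable_no_minor (R : realType) (G : sgraph) (A : {set G}) :
  ~ minor K4minus G -> realizable R A.
Proof.
move=> noK; have [n] := ubnP #|A|; elim: n A => // n IH A; rewrite ltnS => An.
(* The induction hypothesis enters only here; [splitU] is the case of complementary parts. *)
have split (B C : {set G}) : B :|: C = A -> B != A -> C != A ->
    {in B :\: C & C :\: B, forall x y, ~~ adj x y} ->
    (#|B :&: C| <= 1)%N -> realizable R A.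
  move=> BC BA CA noadj BC1; rewrite -BC; apply: realizable_glue => //.
  - apply: IH; apply: leq_trans An; apply: proper_card.
    by rewrite finset.properEneq BA -BC finset.subsetUl.
  - apply: IH; apply: leq_trans An; apply: proper_card.
    by rewrite finset.properEneq CA -BC finset.subsetUr.
have splitU (B : {set G}) : B \subset A -> B != finset.set0 -> B != A ->
    {in B & A :\: B, forall x y, ~~ adj x y} -> realizable R A.
  move=> BA B0 BnA noadj; apply: (split B (A :\: B)) => //.
  - by apply/finset.setP => z; rewrite !inE; case: (boolP (z \in B)) => //= /(fintype.subsetP BA).
  - apply: contra B0 => /eqP e; rewrite -finset.subset0; apply/fintype.subsetP => z zB.
    by have := fintype.subsetP BA _ zB; rewrite -e inE zB.
  - move=> x y; rewrite !inE => /andP[_ xB] /andP[yB /andP[_ yA]].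
    by apply: noadj; rewrite ?inE ?yB.
  - by rewrite leq_eqVlt ltnS leqn0 cards_eq0; apply/orP; right;
      apply/eqP/finset.setP => z; rewrite !inE; case: (z \in B).
case: (leqP #|A| 1) => [|A2]; first exact: realizable_le1.
have /card_gt0P[a aA] : (0 < #|A|)%N by apply: ltnW.
case: (boolP [exists b in A, adj a b]) => [/exists_inP[b bA ab]|]; last first.
  (* A vertex without neighbours in [A] splits off. *)
  rewrite negb_exists_in => /forall_inP na; apply: (splitU [set a]) => //.
  - by rewrite finset.sub1set.
  - by apply/finset.set0Pn; exists a; rewrite inE.
  - by apply: contraTneq A2 => <-; rewrite cards1.
  - by move=> x y; rewrite !inE => /eqP -> /andP[_ yA]; apply: na.
have [c [uc cA c1 cc csep]] := exists_separated_cycle noK aA bA ab.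
set e := off_cycle A c in csep.
have eA u v : u \in A -> connect e u v -> v \in A.
  move=> uA /connectP[p up ->].
  by have := mem_last u p; rewrite in_cons => /predU1P[->//|/(off_cycle_path_sub up)].
have edgeA u v : u \in A -> v \in A -> adj u v -> ~~ cycle_edge c u v -> connect e u v.
  by move=> uA vA uv nc; apply: connect1; rewrite /e /off_cycle uA vA uv.
have cycle_edge_mem u v : adj u v -> cycle_edge c u v -> u \in c /\ v \in c.
  move=> uv; wlog: u v uv / next c u == v => [h|/eqP vE _].
    by case/orP=> h'; [|rewrite and_comm]; apply: h; rewrite ?h' // 1?adj_sym ///cycle_edge h'.
  case: (boolP (u \in c)) => uc'; first by rewrite -vE mem_next uc'.
  by move: uv; rewrite -vE next_nth (negbTE uc') adj_irr.
have [[w [wc [z [zw wz]]]]|triv] :=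
  pselect (exists w, w \in c /\ exists z, z != w /\ connect e w z).
  (* [B] is the piece of [A] hanging at [w]; the other part is the rest with [w] put back, so they
     share only [w]. *)
  pose B := [set x in A | connect e w x].
  have inB x : (x \in B) = (x \in A) && connect e w x by rewrite finset.in_set.
  have wB : w \in B by rewrite inB cA ?connect0.
  apply: (split B (w |: (A :\: B))).
  - apply/finset.setP => x; rewrite !finset.inE.
    by case: eqP => [->|_]; rewrite ?(cA _ wc) ?connect0 //; case: (x \in A);
      rewrite ?andbF //= andbT orbN.
  - have wn : adj w (next c w) := next_cycle cc wc.
    apply: contraTneq wn => BA.
    have : next c w \in B by rewrite BA cA ?mem_next.
    by rewrite inB => /andP[_ /csep <-]; rewrite ?mem_next ?adj_irr.
  - apply: contraNneq zw => CA; have : z \in A by apply: eA wz; apply: cA.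
    rewrite -CA finset.inE finset.in_set1 => /orP[//|].
    by rewrite finset.in_setD inB wz (eA _ _ (cA _ wc) wz).
  - move=> x y /finset.setDP[xB xC] /finset.setDP[yC yB].
    have xw : x != w by apply: contraNneq xC => ->; rewrite finset.setU11.
    have yA : y \in A.
      by case/finset.setU1P: yC => [yw|/finset.setDP[]//]; rewrite yw wB in yB.
    move: xB; rewrite inB => /andP[xA wx]; apply/negP => xy.
    (* A crossing edge of [c] would have [x] on [c], forcing [x = w]; any other crossing edge would
       bring [y] into [B]. *)
    case: (boolP (cycle_edge c x y)) => [/(cycle_edge_mem _ _ xy)[xc _]|nxy].
      by move: xw; rewrite (csep _ _ wc xc wx) eqxx.
    by move: yB; rewrite inB yA (connect_trans wx (edgeA _ _ xA yA xy nxy)).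
  - apply: (@leq_trans #|[set w]|); last by rewrite cards1.
    apply/subset_leq_card/fintype.subsetP => x.
    by rewrite !finset.inE; case: (x == w) => //= /andP[->].
have ctriv w z : w \in c -> connect e w z -> z = w.
  move=> wc wz; apply/eqP/negP => /negP zw; apply: triv.
  by exists w; split=> //; exists z.
(* Nothing hangs at the cycle any more: either it is cut off from the rest of [A], or it is all of
   [A] and has no chord. *)
have [cE|cNA] := eqVneq [set x in c] A; last first.
  apply: (splitU [set x in c]) => //.
  - by apply/fintype.subsetP => x; rewrite inE => /cA.
  - case: (c) c1 => // v ? _; apply/finset.set0Pn; exists v.
    by rewrite finset.in_set mem_head.
  - move=> x y; rewrite !inE => xc /andP[yc yA]; apply/negP => xy.
    case: (boolP (cycle_edge c x y)) => [/(cycle_edge_mem _ _ xy)[_ yc']|nxy].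
      by rewrite yc' in yc.
    have /(ctriv _ _ xc) yx := edgeA _ _ (cA _ xc) yA xy nxy.
    by rewrite yx xc in yc.
rewrite -cE; apply: realizable_cycle => // x y xc yc.
rewrite -/(cycle_edge c x y); apply/idP/idP => [xy|].
  apply/negPn/negP => nxy.
  have /(ctriv _ _ xc) yx := edgeA _ _ (cA _ xc) (cA _ yc) xy nxy.
  by move: xy; rewrite yx adj_irr.
case/orP=> /eqP <-; last rewrite adj_sym; exact: (next_cycle cc).
Qed.

(** * Unit-distance graphs and distance-numbers *)

Lemma unit_distance_range (R : realType) (G : sgraph) (p : G -> plane R) :
    injective p -> (forall x y : G, adj x y <-> dist (p x) (p y) = 1) ->
  graph_iso (@adj G) (@unit_distance R (range p)).
Proof.
move=> pI pd.
have pS x : p x \in range p by apply/mem_set; exists x.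
(* Boolean equality lets [xchoose] define the inverse map. *)
have vE (u : range p) : exists x, p x == val u.
  by have [x _ xE] := set_mem (valP u); exists x; apply/eqP.
exists (fun x => exist _ (p x) (pS x)).
  exists (fun u => xchoose (vE u)) => [x|u].
    by apply: pI; exact/eqP/(xchooseP (vE _)).
  by apply: val_inj; exact/eqP/(xchooseP (vE u)).
by move=> x y; apply/eqP/idP => /pd.
Qed.

Lemma num_lengths_gt0 (R : realType) (G : sgraph) (p : G -> plane R) (x y : G) :
  adj x y -> (0 < num_lengths p)%N.
Proof.
move=> xy; have : dist (p x) (p y) \in edge_lengths p.
  by rewrite mem_undup; apply/fintype.imageP; exists (x, y).
by rewrite /num_lengths; case: (edge_lengths p).
Qed.

Lemma num_lengths_le1 (R : realType) (G : sgraph) (p : G -> plane R) :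
  (forall x y : G, adj x y -> dist (p x) (p y) = 1) -> (num_lengths p <= 1)%N.
Proof.
move=> pd; apply: (@uniq_leq_size _ _ [:: 1]); first exact: undup_uniq.
by move=> d; rewrite mem_undup inE => /fintype.imageP[u uv ->]; apply/eqP/pd.
Qed.

(** Without edges there are no lengths and both minima are 0, hence the condition on the last
    claim. *)
Theorem theorem8 (R : realType) (G : sgraph) (hG : ~ minor K4minus G) :
  (exists2 p : G -> plane R, drawing p &
     forall x y : G, adj x y <-> dist (p x) (p y) = 1) /\
  (exists S : set (plane R), graph_iso (@adj G) (@unit_distance R S)) /\
  ((exists x y : G, adj x y) -> dn' R G = 1%N /\ dn R G = 1%N).
Proof.
have [p [pI pd ps]] := realizable_no_minor R [set: G] hG.
have {}pI : injective p by move=> x y; apply: pI; rewrite finset.in_setT.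
have {}pd (x y : G) : adj x y <-> dist (p x) (p y) = 1.
  by rewrite dist_eq1; apply: pd; rewrite finset.in_setT.
have pD : drawing p by split=> // x y z; apply: ps; rewrite finset.in_setT.
split; first by exists p.
split; first by exists (range p); apply: unit_distance_range.
case=> x [y xy].
have p1 : (num_lengths p <= 1)%N by apply: num_lengths_le1 => u v /pd.
(* The drawing [p] bounds both minima above; the edge [xy] contributes a length to every competing
   placement. *)
split; apply/anti_leq/andP; split.
- rewrite /dn'; case: ex_minnP => m _ min; apply: leq_trans p1.
  by apply/min/asboolP; exists p.
- rewrite /dn'; case: ex_minnP => m /asboolP[q _ <-] _; exact: num_lengths_gt0 xy.
- rewrite /dn; case: ex_minnP => m _ min; apply: leq_trans p1.
  by apply/min/asboolP; exists p.
- rewrite /dn; case: ex_minnP => m /asboolP[q _ <-] _; exact: num_lengths_gt0 xy.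
Qed.
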